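(* Consider the random sequential adsorption process with nearest-neighbor exclusion on the one-dimensional lattice $\mathbb{Z}$, and let $\rho_t$ denote the density of occupied sites up to time $t$, i.e. $\rho_t=\mathbb{P}(\omega_s(t)=1)$, a quantity which does not depend on $s\in\mathbb{Z}$. For all $t\in[0,1]$ and all $s\in\mathbb{Z}$, $$\rho_t=\mathbb{P}(\omega_s(t)=1)=\frac{1-e^{-2t}}{2}.$$
   Context: Let $T=(t_s)_{s\in\mathbb{Z}}$ be a family of i.i.d. random variables uniformly distributed on $[0,1]$, with product law $\mathbb{P}$ on $[0,1]^{\mathbb{Z}}$. The random sequential adsorption (RSA) process with nearest-neighbor exclusion on $\mathbb{Z}$ is defined as follows. At time $0$ all sites are vacant; at time $t_s$ the site $s$ becomes occupied (and stays occupied forever) if and only if both $s-1$ and $s+1$ are vacant at time $t_s$; there is no other attempt to occupy $s$. Write $\omega_s(t)=\omega_s(T,t)\in\{0,1\}$ for the state of site $s$ at time $t\in[0,1]$ ($1$ = occupied, $0$ = vacant). Thus $\omega_s(t)=1$ if and only if $t_s\le t$, $\omega_{s-1}(t_s)=0$ and $\omega_{s+1}(t_s)=0$. For $\mathbb{P}$-almost every $T$ these rules determine $\omega_s(t)$ uniquely for all $s\in\mathbb{Z}$ and $t\in[0,1]$. By translation invariance $\mathbb{P}(\omega_s(t)=1)$ has the same value for all $s\in\mathbb{Z}$; by ergodicity of the translations of $\mathbb{Z}$ this common value coincides with the density of occupied sites up to time $t$, and it is denoted $\rho_t$. *)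

(* Defs.v *)
From HB Require Import structures.
From mathcomp Require Import all_boot all_order all_algebra finmap.
From mathcomp Require Import all_classical all_reals all_analysis.

Set Implicit Arguments.
Unset Strict Implicit.
Unset Printing Implicit Defensive.

Import Order.TTheory GRing.Theory Num.Theory.
Import numFieldNormedType.Exports.

Local Open Scope classical_set_scope.
Local Open Scope ring_scope.

Definition mutually_independent d (Omega : measurableType d) (R : realType)
    (P : probability Omega R) (I : choiceType) (X : I -> {RV P >-> R}) : Prop :=
  forall (J : {fset I}) (B : I -> set R), (forall i, measurable (B i)) ->
    P (\bigcap_(i in [set` J]) (X i @^-1` B i)) =
    \big[*%E/1%E]_(i <- J) P (X i @^-1` B i).

Definition uniform01 d (Omega : measurableType d) (R : realType)
    (P : probability Omega R) (X : {RV P >-> R}) : Prop :=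
  forall B : set R, measurable B ->
    distribution P X B = uniform_prob (@ltr01 R) B.

Definition iid_uniform01 d (Omega : measurableType d) (R : realType)
    (P : probability Omega R) (I : choiceType) (X : I -> {RV P >-> R}) : Prop :=
  mutually_independent X /\ forall i, uniform01 (X i).

(* [w s t] is the state of site [s] at time [t] ([true] = occupied) and [tau s]
   is the attempt time of [s].  The rules are imposed at every real [t]: when
   all attempt times lie in [0, 1], the states in [0, 1] determine the others
   (vacant before time 0, frozen after time 1). *)
Definition rsa_trajectory (R : realType) (tau : int -> R)
    (w : int -> R -> bool) : Prop :=
  forall (s : int) (t : R),
    w s t = [&& tau s <= t, ~~ w (s - 1) (tau s) & ~~ w (s + 1) (tau s)].

(* The trajectory determined by the rules; on the (null) set of attempt times
   for which the rules do not determine it uniquely, every site is declared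
   vacant. *)
Definition rsa_state (R : realType) (tau : int -> R) (s : int) (t : R) : bool :=
  `[< exists2 w, unique (rsa_trajectory tau) w & w s t >].

Lemma rsa_stateE (R : realType) (tau : int -> R) (w : int -> R -> bool) :
  unique (rsa_trajectory tau) w -> rsa_state tau = w.
Proof.
move=> uw; apply/funext => s; apply/funext => t; apply/asboolP/idP.
  by move=> [v [rv _]]; rewrite (uw.2 v rv).
by move=> wst; exists w.
Qed.

Definition omega d (Omega : measurableType d) (R : realType)
    (P : probability Omega R) (T : int -> {RV P >-> R})
    (s : int) (t : R) (x : Omega) : bool :=
  rsa_state (fun i => T i x) s t.

(* The common value of the occupation probabilities, read off at the origin. *)
Definition rho d (Omega : measurableType d) (R : realType)
    (P : probability Omega R) (T : int -> {RV P >-> R}) (t : R) : \bar R :=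
  P [set x | omega T 0 t x = true].

(* Main.v *)
Require Import Defs.
From HB Require Import structures.
From mathcomp Require Import all_boot all_order all_algebra finmap.
From mathcomp Require Import all_classical all_reals all_analysis.
From mathcomp Require Import measurable_realfun zify lra ring.

Set Implicit Arguments.
Unset Strict Implicit.
Unset Printing Implicit Defensive.

Import Order.TTheory GRing.Theory Num.Theory.
Import numFieldNormedType.Exports.

Local Open Scope classical_set_scope.
Local Open Scope ring_scope.

(** Call a site free when both of its neighbours are vacant at its own attempt
    time.  A trajectory is the same thing as a fixed point of the map
    [rsa_update], which computes the free sites from the free neighbours that
    tried earlier.  This map is antitone, so its iterates from the empty
    configuration bracket every fixed point: the even ones increase to
    [surely_free], the odd ones decrease to [possibly_free].  If the two limits
    agree, they are the only fixed point; if they differ somewhere, the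
    undetermined sites can be filled according to the parity of the site, in two
    different ways, so that there is no uniqueness.  Hence uniqueness of the
    trajectory is the event that the two limits agree, which is measurable since
    each iterate at a site depends on finitely many attempt times
    ([rsa_state_free]).

    It remains to compute the law of the iterates.  When no two neighbours tie,
    a site [s] only looks at neighbours that tried before it, and these do not
    look back at [s].  So the problem splits at [s] into two half-lines:
    [rsa_iter n.+1 s] says that [s] tries before the occupation time of its left
    and of its right neighbour, each in the process on its own half-line
    truncated at [n] sites ([rsa_iter_half_time]).  These two times and the
    attempt time of [s] depend on disjoint sets of attempt times, hence are
    independent.  If [g n u] is the probability that the first site of a
    half-line of [n] sites is still vacant at time [u], then conditioning on the
    attempt time of that site gives [g n.+1 u = 1 - \int_0^u g n], so that [g n]
    is the Taylor polynomial of [exp(-u)] of degree [n] ([half_time_law]).  For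
    the same reason, the probability that [s] has tried by time [t] and satisfies
    [rsa_iter n.+1 s] is [\int_0^t (g n)^2] ([iter_occupied_law]), which tends
    to [\int_0^t exp(-2u) du = (1 - exp(-2t)) / 2] by dominated convergence.

    The even and the odd iterates thus give the same limit.  Both brackets have
    this probability ([surely_occupied_law]), so they agree almost surely and the
    trajectory is almost surely unique with the announced density. *)

(** * Free sites and the bracketing of trajectories *)

Section Update.
Context (R : realType) (tau : int -> R).

Definition rsa_update (b : int -> bool) (s : int) : bool :=
  ~~ ((tau (s - 1) <= tau s) && b (s - 1)) &&
  ~~ ((tau (s + 1) <= tau s) && b (s + 1)).

Definition rsa_iter (n : nat) : int -> bool := iter n rsa_update (fun=> false).

Definition surely_free (s : int) : bool := `[< exists n, rsa_iter n.*2 s >].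

Definition possibly_free (s : int) : bool :=
  `[< forall n, rsa_iter n.*2.+1 s >].

Lemma rsa_update_anti (b c : int -> bool) :
  (forall s, b s -> c s) -> forall s, rsa_update c s -> rsa_update b s.
Proof.
move=> bc s /andP[/negP h1 /negP h2].
apply/andP; split; apply/negP => /andP[le1 bs].
  by apply: h1; rewrite le1 bc.
by apply: h2; rewrite le1 bc.
Qed.

Lemma rsa_iter_even_step (n : nat) s :
  rsa_iter n.*2 s -> rsa_iter n.+1.*2 s.
Proof.
elim: n s => [//|n IH] s.
rewrite [in X in X -> _]doubleS [n.+2.*2]doubleS /=.
by apply: rsa_update_anti => r; apply: rsa_update_anti => q; exact: IH.
Qed.

Lemma rsa_iter_even_mono (m n : nat) s :
  (m <= n)%N -> rsa_iter m.*2 s -> rsa_iter n.*2 s.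
Proof.
move=> /subnK <- + ; elim: (n - m)%N => [//|k IH] /IH {IH}.
by rewrite addSn; exact: rsa_iter_even_step.
Qed.

Lemma rsa_iter_odd_anti (m n : nat) s :
  (m <= n)%N -> rsa_iter n.*2.+1 s -> rsa_iter m.*2.+1 s.
Proof. by move=> mn; apply: rsa_update_anti => r; exact: rsa_iter_even_mono. Qed.

Lemma rsa_iter_fixpoint (b : int -> bool) :
  (forall s, b s = rsa_update b s) ->
  forall n s, (rsa_iter n.*2 s -> b s) /\ (b s -> rsa_iter n.*2.+1 s).
Proof.
move=> fb; elim=> [|n IH] s; first by split=> //;
  rewrite fb; exact: rsa_update_anti.
have ev r : rsa_iter n.+1.*2 r -> b r.
  by rewrite fb; apply: rsa_update_anti => q; have [] := IH q.
by split=> [|]; [exact: ev|rewrite fb; exact: rsa_update_anti].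
Qed.

(** Passing to the limit in [rsa_update] exchanges the two brackets, because the
    update at a site only reads two sites and the iterates are monotone. *)
Lemma rsa_update_surely s : rsa_update surely_free s = possibly_free s.
Proof.
apply/idP/asboolP => [up n|up].
  by apply: rsa_update_anti up => r rn; apply/asboolP; exists n.
apply/andP; split; apply/negP => /andP[le1 /asboolP[n rn]].
  by have /andP[/negP + _] := up n; apply; rewrite le1.
by have /andP[_ /negP +] := up n; apply; rewrite le1.
Qed.

Lemma rsa_update_possibly s : rsa_update possibly_free s = surely_free s.
Proof.
apply/idP/asboolP => [/andP[h1 h2]|[n fn]]; last first.
  case: n fn => // n; apply: rsa_update_anti => r /asboolP; exact.
have side r : ~~ ((tau r <= tau s) && possibly_free r) ->
    exists n, forall m, (n <= m)%N -> ~~ ((tau r <= tau s) && rsa_iter m.*2.+1 r).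
  move=> /nandP[/negbTE ->|/asboolPn]; first by exists 0%N.
  rewrite -existsNE => -[n nr]; exists n => m nm.
  by apply/negP => /andP[_ /(rsa_iter_odd_anti nm)].
have [n1 f1] := side _ h1; have [n2 f2] := side _ h2.
exists (maxn n1 n2).+1; rewrite doubleS.
by apply/andP; split; [apply: f1; exact: leq_maxl|apply: f2; exact: leq_maxr].
Qed.

Lemma surely_possibly s : surely_free s -> possibly_free s.
Proof.
move=> /asboolP[m ms]; apply/asboolP => n.
have {}ms := rsa_iter_even_mono (leq_maxl m n) ms.
apply: (rsa_iter_odd_anti (leq_maxr m n)).
move: (maxn m n) s ms => {m}{}n; elim: n => [//|n IH] s.
rewrite doubleS; apply: rsa_update_anti => r; apply: rsa_update_anti => q.
exact: IH.
Qed.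

(** An undetermined site has no surely free neighbour that tried no later, but
    at least one such neighbour that is undetermined.  Since neighbours have opposite
    parities, declaring the undetermined sites of one parity free is
    consistent.  Taking either parity gives two trajectories as soon as there is
    one undetermined site. *)
Lemma rsa_update_parity (p : bool) s :
  let b r := surely_free r || (possibly_free r && (odd `|r|%N == p)) in
  rsa_update b s = b s.
Proof.
move=> b.
have par (r e : int) : e = 1 \/ e = -1 -> odd `|(r + e)%R|%N = ~~ odd `|r|%N.
  by case=> ->; lia.
have bL r : surely_free r -> b r by rewrite /b => ->.
have bG r : b r -> possibly_free r.
  by rewrite /b => /orP[/surely_possibly //|/andP[]].
apply/idP/idP => [ub|bs].
  have Gs : possibly_free s.
    by rewrite -rsa_update_surely; exact: rsa_update_anti ub.
  rewrite /b; case Ls : (surely_free s) => //=; rewrite Gs /=.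
  apply: contraFT Ls => sp.
  rewrite -rsa_update_possibly; case/andP: ub => /negP u1 /negP u2.
  apply/andP; split; apply/negP => /andP[le1 Gr].
    by apply: u1; rewrite le1 /b Gr par; [|right];
      move: sp; case: (odd _); case: (p); rewrite ?orbT.
  by apply: u2; rewrite le1 /b Gr par; [|left];
    move: sp; case: (odd _); case: (p); rewrite ?orbT.
move: bs; rewrite /b => /orP[|/andP[+ sp]].
  by rewrite -rsa_update_possibly; exact: rsa_update_anti.
rewrite -rsa_update_surely => /andP[/negP u1 /negP u2].
apply/andP; split; apply/negP => /andP[le1 /orP[Lr|/andP[_]]].
- by apply: u1; rewrite le1.
- by rewrite par; [rewrite -(eqP sp); case: (odd _)|right].
- by apply: u2; rewrite le1.
- by rewrite par; [rewrite -(eqP sp); case: (odd _)|left].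
Qed.

Lemma fixpoint_trajectory (b : int -> bool) :
  (forall s, rsa_update b s = b s) ->
  rsa_trajectory tau (fun s t => (tau s <= t) && b s).
Proof. by move=> fb s t; rewrite -fb. Qed.

Lemma trajectory_fixpoint (w : int -> R -> bool) : rsa_trajectory tau w ->
  exists2 b, forall s, b s = rsa_update b s &
    forall s t, w s t = (tau s <= t) && b s.
Proof.
move=> tw; pose b s := ~~ w (s - 1) (tau s) && ~~ w (s + 1) (tau s).
have wE s t : w s t = (tau s <= t) && b s by exact: tw.
by exists b => // s; rewrite {1}/b !wE.
Qed.

(** This replaces the existence and uniqueness of a function on all sites and
    times by countably many conditions on finitely many attempt times each, which
    is what makes the occupation events measurable. *)
Lemma rsa_state_free s t : rsa_state tau s t =
  `[< forall r, possibly_free r -> surely_free r >] &&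
  (tau s <= t) && surely_free s.
Proof.
have [tot|ntot] := pselect (forall r, possibly_free r -> surely_free r).
  rewrite (asboolT tot) /=.
  pose w s t := (tau s <= t) && surely_free s.
  rewrite (@rsa_stateE _ _ w)//; split.
    apply: fixpoint_trajectory => r; rewrite rsa_update_surely.
    by apply/idP/idP => [h|h]; [exact: tot|exact: surely_possibly].
  move=> v /trajectory_fixpoint[b fb vE]; apply/funext => r; apply/funext => u.
  rewrite vE /w; congr (_ && _); apply/idP/idP.
    by move=> /asboolP[n rn]; have [/(_ rn)] := rsa_iter_fixpoint fb n r.
  move=> br; apply: tot; apply/asboolP => n.
  by have [_ /(_ br)] := rsa_iter_fixpoint fb n r.
rewrite (asboolF ntot) /=; apply/asboolPn => -[w [tw uw] _].
move: ntot; rewrite -existsNE => -[r /not_implyP[Gr /negP/negbTE nLr]].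
have two p := uw _ (fixpoint_trajectory (fun s => rsa_update_parity p s)).
have := etrans (esym (two true)) (two false) => /(congr1 (fun v => v r (tau r))).
by rewrite lexx Gr nLr /=; case: (odd _).
Qed.

End Update.

(** * Independence of events about disjoint sets of attempt times *)

Section Independence.
Context d (Omega : measurableType d) (R : realType) (P : probability Omega R).

(** Both sides of the product rule are finite measures in the second event, so it
    is enough to check it on a generating class closed under intersection. *)
Lemma indep_sigma_right (E : set Omega) (G : set (set Omega)) :
  measurable E -> G `<=` measurable -> G setT -> setI_closed G ->
  (forall F, G F -> P (E `&` F) = (P E * P F)%E) ->
  forall F, <<s G >> F -> P (E `&` F) = (P E * P F)%E.
Proof.
move=> mE mG GT GI EG F sF.
have fE : P E \is a fin_num by exact: fin_num_measure.
have PE0 : 0 <= fine (P E) by rewrite fine_ge0.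
pose m1 : {measure set Omega -> \bar R} := mrestr P mE.
pose m2 : {measure set Omega -> \bar R} := mscale (NngNum PE0) P.
have m2E A : m2 A = (P E * P A)%E by rewrite /m2 /= /mscale /= fineK.
rewrite -m2E setIC; change (m1 F = m2 F).
apply: (@g_sigma_algebra_measure_unique _ _ _ G mG (fun=> setT)) => //.
- by rewrite bigcup_const.
- by move=> A GA; rewrite m2E -EG// setIC.
- by move=> _; rewrite /m1 /= /mrestr setTI -ge0_fin_numE.
Qed.

Lemma indep_sigma (G H : set (set Omega)) :
  G `<=` measurable -> H `<=` measurable -> G setT -> H setT ->
  setI_closed G -> setI_closed H ->
  (forall E F, G E -> H F -> P (E `&` F) = (P E * P F)%E) ->
  forall E F, <<s G >> E -> <<s H >> F -> P (E `&` F) = (P E * P F)%E.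
Proof.
move=> mG mH GT HT GI HI GH E F sE sF.
have mE : measurable E.
  by apply: (smallest_sub (@sigma_algebra_measurable _ Omega) mG).
apply: (indep_sigma_right mE mH) => // B HB.
rewrite setIC muleC; apply: (indep_sigma_right (mH _ HB) mG) => // A GA.
by rewrite setIC muleC GH.
Qed.

Context (I : choiceType) (X : I -> {RV P >-> R}).

(** A class closed under intersection that generates the events determined by the
    variables indexed by [A]: on it, independence is the defining product rule. *)
Definition cylinders (A : set I) : set (set Omega) :=
  [set E | exists (J : {fset I}) (B : I -> set R),
    [/\ [set` J] `<=` A, (forall i, measurable (B i)) &
      E = \bigcap_(i in [set` J]) (X i @^-1` B i)]].

Lemma cylinders_measurable A : cylinders A `<=` measurable.
Proof.
move=> _ [J [B [_ mB ->]]]; apply: fin_bigcap_measurable => // i _.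
by rewrite -[_ @^-1` _]setTI; exact: measurable_funP.
Qed.

Lemma cylindersT A : cylinders A setT.
Proof.
exists (@fset0 I), (fun=> setT); split=> //.
by rewrite eqEsubset; split=> // x _ i _.
Qed.

Lemma cylindersI A : setI_closed (cylinders A).
Proof.
move=> _ _ [J [B [JA mB ->]]] [K [C [KA mC ->]]].
pose D i := (if i \in J then B i else setT) `&` (if i \in K then C i else setT).
exists (J `|` K)%fset, D; split.
- by move=> i /=; rewrite inE => /orP[/JA|/KA].
- by move=> i; apply: measurableI; case: ifP.
- rewrite eqEsubset; split=> x /= => [[Bx Cx] i _|Dx].
    by split; case: ifPn => // iJ; [exact: Bx|exact: Cx].
  split=> i /= iJ.
    by have /Dx[+ _] : i \in (J `|` K)%fset; rewrite ?inE iJ.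
  by have /Dx[_ +] : i \in (J `|` K)%fset; rewrite ?inE iJ ?orbT.
Qed.

Hypothesis indepX : mutually_independent X.

Lemma cylinders_indep A A' E F : A `&` A' = set0 ->
  cylinders A E -> cylinders A' F -> P (E `&` F) = (P E * P F)%E.
Proof.
move=> AA' [J [B [JA mB ->]]] [K [C [KA mC ->]]].
have dJK : [disjoint J & K]%fset.
  apply/fdisjointP => i iJ; apply/negP => iK.
  suff : (A `&` A') i by rewrite AA'.
  by split; [exact: JA|exact: KA].
pose D i := if i \in J then B i else C i.
have mD i : measurable (D i) by rewrite /D; case: ifP.
have DJ i : i \in J -> D i = B i by rewrite /D => ->.
have DK i : i \in K -> D i = C i.
  by rewrite /D; case: ifPn => // /(fdisjointP dJK)/negbTE ->.
rewrite (eq_bigcapr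
  (_ : forall i, [set` J] i -> X i @^-1` B i = X i @^-1` D i)); last first.
  by move=> i /= /DJ ->.
rewrite (eq_bigcapr
  (_ : forall i, [set` K] i -> X i @^-1` C i = X i @^-1` D i)); last first.
  by move=> i /= /DK ->.
rewrite -bigcap_setU -set_fsetU !indepX//.
rewrite -big_cat; apply: perm_big; apply: uniq_perm => //.
  rewrite cat_uniq !fset_uniq andbT /=; apply/hasPn => i /=.
  by apply: contraL => /(fdisjointP dJK).
by move=> i; rewrite inE mem_cat.
Qed.

Definition sigma_of (A : set I) : set (set Omega) := <<s cylinders A >>.

Lemma sigma_of_indep A A' E F : A `&` A' = set0 ->
  sigma_of A E -> sigma_of A' F -> P (E `&` F) = (P E * P F)%E.
Proof.
move=> AA'; apply: indep_sigma;
  [exact: cylinders_measurable..|exact: cylindersT|exact: cylindersT|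
   exact: cylindersI|exact: cylindersI|].
by move=> ? ?; exact: cylinders_indep.
Qed.

Definition sigma_type (A : set I) := g_sigma_algebraType (cylinders A).

Lemma measurable_coord (A : set I) i : A i ->
  measurable_fun setT (X i : sigma_type A -> R).
Proof.
move=> Ai _ B mB; rewrite setTI; apply: sub_sigma_algebra.
exists [fset i]%fset, (fun=> B); split=> //.
  by move=> j /=; rewrite inE => /eqP ->.
by rewrite set_fset1 bigcap_set1.
Qed.

End Independence.

(** * Conditioning on a uniform variable *)

Lemma measurable_bool_set d (T : measurableType d) (f : T -> bool) :
  measurable_fun setT f -> measurable [set x | f x].
Proof. by move=> /(_ measurableT [set true] I); rewrite setTI. Qed.

Section JointLaw.
Context d (Omega : measurableType d) (R : realType) (P : probability Omega R).
Local Open Scope ereal_scope.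

(** Conditioning on the value of [X]: the joint law of independent variables is
    the product of their laws, and the law of [X] is Lebesgue measure on the unit
    interval. *)
Lemma uniform_joint_law (X : {RV P >-> R}) (Y : Omega -> R) (S : set (R * R)) :
  uniform01 X -> measurable_fun setT Y ->
  (forall A B, measurable A -> measurable B ->
    P (X @^-1` A `&` Y @^-1` B) = P (X @^-1` A) * P (Y @^-1` B)) ->
  measurable S ->
  P [set w | S (X w, Y w)] =
    \int[lebesgue_measure]_(x in `[0%R, 1%R]) P [set w | S (x, Y w)].
Proof.
move=> uX mY indXY mS.
pose Y' : {mfun Omega >-> R} := mfun_Sub (mem_set mY).
have mXY : measurable_fun setT (fun w => (X w, Y' w)).
  by apply: measurable_fun_pair => //; exact: measurable_funP.
pose XY : {mfun Omega >-> (R * R)%type} := mfun_Sub (mem_set mXY).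
have := @product_measure_unique _ _ _ _ _ (distribution P X)
  (distribution P Y') (distribution P XY) indXY S mS.
move=> jE; rewrite -[LHS]/(distribution P XY S) -jE.
rewrite /product_measure1.
have mf := measurable_fun_xsection (distribution P Y') mS.
have mX : @measurable_fun _ _ Omega (measurableTypeR R) setT X.
  exact: (measurable_funP X).
(* The real line carries two measurable structures that have the same measurable
   sets but are distinct as structures: the law of [X] lives on one of them, the
   uniform law on the other.  Writing the integral over the law of [X] as an
   integral over [P] moves it from one to the other. *)
pose X' : {mfun Omega >-> measurableTypeR R} :=
  @mfun_Sub _ _ Omega (measurableTypeR R) X (mem_set mX).
pose mu1 : {measure set (measurableTypeR R) -> \bar R} := distribution P X'.
pose mu2 : {measure set (measurableTypeR R) -> \bar R} :=
  @uniform_prob R 0%R 1%R (@ltr01 R).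
pose f : R -> \bar R := distribution P Y' \o xsection S.
have f0 x : 0 <= f x by exact: measure_ge0.
transitivity (\int[mu1]_x f x).
  by rewrite /mu1 !ge0_integral_distribution.
rewrite (@eq_measure_integral _ _ _ _ mu2 mu1); last first.
  by move=> A mA _; exact: uX.
rewrite integral_uniform.
- rewrite subr0 invr1 mul1e; apply: eq_integral => x _ /=.
  by congr (P _); apply/seteqP; split=> w /=; rewrite /xsection /= inE.
- exact: mf.
- exact: f0.
Qed.

(** The basic step of all the computations: [X] is the attempt time of a site, and
    [Y] is the time at which a neighbour would block it. *)
Lemma uniform_lt (X : {RV P >-> R}) (Y : Omega -> R) (f : R -> R) (u : R) :
  uniform01 X -> measurable_fun setT Y ->
  (forall A B, measurable A -> measurable B ->
    P (X @^-1` A `&` Y @^-1` B) = P (X @^-1` A) * P (Y @^-1` B)) ->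
  (0 <= u <= 1)%R ->
  (forall x, (0 <= x <= 1)%R -> P [set w | (x < Y w)%R] = (f x)%:E) ->
  P [set w | (X w <= u)%R && (X w < Y w)%R] =
    \int[lebesgue_measure]_(x in `[0%R, u]) (f x)%:E.
Proof.
move=> uX mY indXY /andP[u0 u1] fY.
pose S := [set xy : R * R | (xy.1 <= u)%R && (xy.1 < xy.2)%R].
have mS : measurable S.
  by apply/measurable_bool_set/measurable_and;
    [apply: measurable_fun_ler|apply: measurable_fun_ltr].
rewrite (uniform_joint_law uX mY indXY mS).
rewrite [RHS]integral_mkcond [LHS]integral_mkcond; apply: eq_integral => x _.
rewrite /patch !mem_setE /S /= !in_itv /=.
have [x0|//] /= := leP 0%R x; have [xu|ux] := leP x u.
  by rewrite (le_trans xu u1) -fY // x0 (le_trans xu u1).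
case: ifP => // _; rewrite (_ : [set w | _] = set0) ?measure0 //.
by apply/seteqP; split.
Qed.

Lemma uniform_neq (X : {RV P >-> R}) (Y : {RV P >-> R}) :
  uniform01 X -> uniform01 Y ->
  (forall A B, measurable A -> measurable B ->
    P (X @^-1` A `&` Y @^-1` B) = P (X @^-1` A) * P (Y @^-1` B)) ->
  P [set w | X w = Y w] = 0.
Proof.
move=> uX uY indXY.
pose S := [set xy : R * R | xy.1 == xy.2].
have mS : measurable S by apply/measurable_bool_set/measurable_fun_eqr.
rewrite (_ : [set w | X w = Y w] = [set w | S (X w, Y w)]); last first.
  by apply/seteqP; split=> w /= /eqP.
rewrite (uniform_joint_law uX _ indXY mS)//; apply: integral0_eq => x _.
rewrite (_ : [set w | S (x, Y w)] = Y @^-1` [set x]); last first.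
  by apply/seteqP; split=> w; rewrite /S /= eq_sym => /eqP.
rewrite -[LHS]/(distribution P Y [set x]) uY//.
apply: (@dominates_uniform_prob R 0%R 1%R (@ltr01 R) [set x]) => //.
by move=> A mA /subset_set1[] ->; [exact: measure0|exact: lebesgue_measure_set1].
Qed.

End JointLaw.

(** * Taylor polynomials of the decaying exponential *)

Section Taylor.
Context (R : realType).
Local Notation mu := (@lebesgue_measure R).

Lemma integral_derivative (F f : R -> R) (a b : R) : a <= b ->
  (forall x : R, is_derive x 1 F (f x)) -> continuous f ->
  (\int[mu]_(x in `[a, b]) (f x)%:E = (F b - F a)%R%:E)%E.
Proof.
rewrite le_eqVlt => /predU1P[<-|ab] dF cf.
  by rewrite set_itv1 integral_set1 subrr.
have cF : continuous F.
  by move=> x; apply/differentiable_continuous/derivable1_diffP; have [] := dF x.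
rewrite (@continuous_FTC2 _ f F)//; first exact: continuous_subspaceT.
- split; first by move=> x _; have [] := dF x.
  + by apply: cvg_at_right_filter; exact: cF.
  + by apply: cvg_at_left_filter; exact: cF.
- by move=> x _; rewrite derive1E; have [_ ->] := dF x.
Qed.

Definition exp_taylor (n : nat) : {poly R} :=
  \sum_(k < n.+1) ((- 1) ^+ k / k`!%:R) *: 'X^k.

Lemma exp_taylorE n x : (exp_taylor n).[x] = series (exp_coeff (- x)) n.+1.
Proof.
rewrite /exp_taylor horner_sum /series /= big_mkord; apply: eq_bigr => k _.
by rewrite hornerZ hornerXn /exp_coeff /= (exprNn x) mulrAC.
Qed.

Lemma exp_taylor0 : exp_taylor 0 = 1.
Proof. by rewrite /exp_taylor big_ord1 expr0 fact0 divr1 scale1r. Qed.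

Lemma exp_taylor_at0 n : (exp_taylor n).[0] = 1.
Proof.
rewrite /exp_taylor horner_sum big_ord_recl big1 => [|k _].
  by rewrite hornerZ hornerXn !expr0 fact0 divr1 addr0 mulr1.
by rewrite hornerZ hornerXn expr0n mulr0.
Qed.

Lemma deriv_exp_taylor n : (exp_taylor n.+1)^`() = - exp_taylor n.
Proof.
rewrite /exp_taylor linear_sum /= big_ord_recl derivZ derivXn mulr0n scaler0 add0r.
rewrite -sumrN; apply: eq_bigr => k _.
rewrite lift0 derivZ derivXn /= -[X in _ *: X = _]scaler_nat scalerA -scaleNr.
congr (_ *: _); rewrite factS natrM exprS; field.
by rewrite nat1r !pnatr_eq0 -lt0n fact_gt0.
Qed.

Lemma exp_taylor_cvg x : (exp_taylor n).[x] @[n --> \oo] --> expR (- x).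
Proof.
have -> : (fun n => (exp_taylor n).[x]) =
    [sequence series (exp_coeff (- x)) n.+1]_n.
  by apply/funext => n; rewrite exp_taylorE.
rewrite cvg_shiftS.
exact: is_cvg_series_exp_coeff.
Qed.

Lemma is_derive_horner (p : {poly R}) (x : R) : is_derive x 1 (horner p) p^`().[x].
Proof.
by apply: DeriveDef; [exact: derivable_horner|rewrite -derive1E -derivE].
Qed.

Lemma continuous_horner (p : {poly R}) : continuous (horner p).
Proof.
by move=> x; apply/differentiable_continuous/derivable1_diffP/derivable_horner.
Qed.

(** Integrating one Taylor polynomial gives the next; this is the recursion
    satisfied by the vacancy probabilities of the truncated half-lines. *)
Lemma integral_exp_taylor n (u : R) : 0 <= u ->
  (\int[mu]_(x in `[0%R, u]) (exp_taylor n).[x]%:E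
    = (1 - (exp_taylor n.+1).[u])%R%:E)%E.
Proof.
move=> u0.
have dF (x : R) : is_derive x 1 (horner (- exp_taylor n.+1)) (exp_taylor n).[x].
  have := is_derive_horner (- exp_taylor n.+1) x.
  by rewrite derivN deriv_exp_taylor opprK.
rewrite (integral_derivative u0 dF (@continuous_horner _)).
by rewrite !hornerN exp_taylor_at0 opprK addrC.
Qed.

Lemma continuous_expRN_sqr : continuous (fun x : R => expR (- x) ^+ 2).
Proof.
by move=> y; apply/differentiable_continuous/derivable1_diffP; exact: ex_derive.
Qed.

Lemma integral_expR_sqr (t : R) : 0 <= t ->
  (\int[mu]_(x in `[0%R, t]) (expR (- x) ^+ 2)%R%:E
    = ((1 - expR (- (2 * t))) / 2)%R%:E)%E.
Proof.
move=> t0.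
have dF (x : R) : is_derive x 1 (fun x => - expR (- (2 * x)) / 2) (expR (- x) ^+ 2).
  apply: is_derive_eq.
  by rewrite -(expRM_natl 2) (mulrN _ x) !scaler0 add0r /GRing.scale /=; field.
rewrite (integral_derivative t0 dF continuous_expRN_sqr).
by rewrite mulr0 oppr0 expR0; congr (_%:E); lra.
Qed.

Lemma cvg_integral_exp_taylor_sqr (t : R) : 0 <= t <= 1 ->
  (forall n x, 0 <= x <= 1 -> 0 <= (exp_taylor n).[x] <= 1) ->
  (\int[mu]_(x in `[0%R, t]) ((exp_taylor n).[x] ^+ 2)%R%:E)%E @[n --> \oo]
    --> ((1 - expR (- (2 * t))) / 2)%:E.
Proof.
move=> /andP[t0 t1] b01; rewrite -integral_expR_sqr//.
have cq n : continuous (fun x : R => (exp_taylor n).[x] ^+ 2).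
  move=> x.
  exact: continuousM (@continuous_horner (exp_taylor n) x)
    (@continuous_horner (exp_taylor n) x).
have mE (h : R -> R) : continuous h -> measurable_fun `[0, t]%classic (EFin \o h).
  move=> ch; apply/measurable_EFinP/measurable_funTS.
  exact: continuous_measurable_fun.
have [//| | | | | | _ _ //] := @dominated_convergence _ _ _ mu `[0, t]%classic _
  (fun n x => ((exp_taylor n).[x] ^+ 2)%:E) (fun x => (expR (- x) ^+ 2)%:E)
  (cst 1%E).
- by move=> n; apply: mE; exact: cq.
- by apply: mE; exact: continuous_expRN_sqr.
- apply: aeW => x _; apply: cvg_EFin; first exact: nearW.
  have h : (exp_taylor n).[x] * (exp_taylor n).[x] @[n --> \oo] -->
      expR (- x) * expR (- x).
    by apply: cvgM; exact: exp_taylor_cvg.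
  exact: h.
- have -> : cst 1%E = EFin \o (cst 1 : R -> R) by [].
  apply: continuous_compact_integrable; first exact: segment_compact.
  by apply: continuous_subspaceT => x; exact: cvg_cst.
- apply: aeW => x n /=; rewrite in_itv /= => /andP[x0 xt].
  have /andP[e0 e1] := b01 n x (introT andP (conj x0 (le_trans xt t1))).
  by rewrite lee_fin ger0_norm ?exprn_ge0// exprn_ile1.
Qed.

End Taylor.

(** * Reduction to two half-lines *)

Section HalfLine.
Context (R : realType) (tau : int -> R) (e : int).

(** Without ties, this is the time at which site [i] becomes occupied in the
    process on the [n] sites [i], [i + e], [i + 2 e], and so on.  The value 2
    means never: it exceeds all times of the unit interval. *)
Fixpoint half_time (n : nat) (i : int) : R :=
  if n is m.+1 then
    if tau i < half_time m (i + e) then tau i else 2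
  else 2.

End HalfLine.

Section NoTies.
Context (R : realType) (tau : int -> R).
Hypothesis tau_le1 : forall i, tau i <= 1.
Hypothesis tau_neq : forall i, tau i != tau (i + 1).

(** Suppose that [s + e] tried before [s].  Whether it was free then depends only
    on the site [s + 2 e] behind it, as [s] itself had not tried yet.  So the two
    sided iterate at [s + e], as seen from [s], follows the recursion of the half
    line.  Without ties, an attempt at [s + e] that is not strictly later than
    that of [s] is strictly earlier, which rules out that [s + e] looks back at
    [s]. *)
Lemma occupied_half_time e n s : e = 1 \/ e = -1 ->
  ((tau (s + e) <= tau s) && rsa_iter tau n (s + e)) =
  ~~ (tau s < half_time tau e n (s + e)).
Proof.
move=> e1.
have lt2 i : tau i < 2 by rewrite (le_lt_trans (tau_le1 i))// ltr1n.
have neq i : tau (i + e) != tau i.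
  case: e1 => ->; first by rewrite eq_sym.
  by have := tau_neq (i - 1); rewrite subrK.
elim: n s => [|n IH] s /=; first by rewrite andbF lt2.
have [le1|gt1] := leP (tau (s + e)) (tau s); last first.
  by case: ifP; rewrite ?gt1 ?lt2.
have ltse : tau (s + e) < tau s by rewrite lt_neqAle neq.
have -> : rsa_update tau (rsa_iter tau n) (s + e) =
    (tau (s + e) < half_time tau e n (s + e + e)).
  rewrite -[RHS]negbK -IH /rsa_update; move: ltse; case: e1 => -> ltse.
    by rewrite addrK [tau s <= _]leNgt ltse.
  by rewrite subrK [tau s <= _]leNgt ltse andbT.
by case: ifP => _; rewrite -leNgt ?le1// leNgt lt2.
Qed.

Lemma rsa_iter_half_time n s : rsa_iter tau n.+1 s =
  (tau s < Num.min (half_time tau 1 n (s + 1)) (half_time tau (-1) n (s - 1))).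
Proof.
rewrite /= /rsa_update.
rewrite lt_min (occupied_half_time n s (or_introl erefl)).
by rewrite (occupied_half_time n s (or_intror erefl)) !negbK andbC.
Qed.

End NoTies.

(** * Measure-theoretic complements *)

Lemma ae_forall_int d (T : measurableType d) (R : realType)
    (mu : {measure set T -> \bar R}) (Q : int -> T -> Prop) :
  (forall s, {ae mu, forall x, Q s x}) -> {ae mu, forall x, forall s, Q s x}.
Proof.
move=> aeQ; have h1 := ae_foralln (fun n => aeQ (Posz n)).
have h2 := ae_foralln (fun n => aeQ (Negz n)).
by apply: filterS2 h1 h2 => x q1 q2 [n|n].
Qed.

Lemma measurable_forall_int d (T : measurableType d) (Q : int -> set T) :
  (forall s, measurable (Q s)) -> measurable [set x | forall s, Q s x].
Proof.
move=> mQ; rewrite (_ : [set x | _] = ~` \bigcup_s ~` Q s).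
  apply: measurableC; apply: countable_bigcupT_measurable => // s.
  exact: measurableC.
rewrite setC_bigcup; apply/seteqP; split=> x qx s.
  by move=> _; rewrite setCK; exact: qx.
by have := qx s I; rewrite setCK.
Qed.

Lemma measure_ae_eq d (T : measurableType d) (R : realType)
    (mu : {measure set T -> \bar R}) (A B : set T) :
  measurable A -> measurable B -> {ae mu, forall x, A x <-> B x} -> mu A = mu B.
Proof.
move=> mA mB [N [mN N0 subN]].
have le A' B' : measurable A' -> measurable B' ->
    (forall x, ~ N x -> A' x -> B' x) -> (mu A' <= mu B')%E.
  move=> mA' mB' AB; rewrite -(measureU0 mB' mN N0).
  apply: le_measure; rewrite ?inE//; first exact: measurableU.
  by move=> x A'x; have [Nx|nNx] := pselect (N x); [right|left; exact: AB].
have AB x : ~ N x -> A x <-> B x by move=> nNx; apply: contrapT => /subN.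
by apply/eqP; rewrite eq_le !le// => x /AB[].
Qed.

(** * The law of the process *)

Section Process.
Context d (Omega : measurableType d) (R : realType) (P : probability Omega R).
Context (T : int -> {RV P >-> R}).

Definition times (x : Omega) : int -> R := fun i => T i x.

(** The sites whose attempt times determine the half-line starting at [i]. *)
Definition ray (e i : int) : set int := [set j | exists k : nat, j = i + e *+ k].

Lemma ray_start e i : ray e i i.
Proof. by exists 0%N; rewrite mulr0n addr0. Qed.

Lemma ray_tail e i : ray e (i + e) `<=` ray e i.
Proof. by move=> _ [k ->]; exists k.+1; rewrite mulrS addrA. Qed.

Lemma measurable_half_time (A : set int) e n i : ray e i `<=` A ->
  measurable_fun setT (fun x : sigma_type T A => half_time (times x) e n i).
Proof.
elim: n i => [|n IH] i iA; first exact: measurable_cst.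
have mi := @measurable_coord _ _ _ P _ T A i (iA _ (ray_start e i)).
have mY := IH (i + e) (subset_trans (@ray_tail e i) iA).
apply: measurable_fun_ifT; [|exact: mi|exact: measurable_cst].
exact: measurable_fun_ltr.
Qed.

Lemma sigma_of_measurable (A : set int) : sigma_of T A `<=` measurable.
Proof.
exact: (smallest_sub (@sigma_algebra_measurable _ Omega)
  (@cylinders_measurable _ _ _ P _ T A)).
Qed.

Lemma measurable_sigma_type (A : set int) (f : Omega -> R) :
  measurable_fun setT (f : sigma_type T A -> R) -> measurable_fun setT f.
Proof.
move=> mf _ B mB; apply: (@sigma_of_measurable A); exact: mf.
Qed.

(** A variable that is measurable on [sigma_type T A] is a function of the attempt
    times in [A] alone. *)
Lemma indep_preimage (A A' : set int) (f g : Omega -> R) :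
  mutually_independent T -> A `&` A' = set0 ->
  measurable_fun setT (f : sigma_type T A -> R) ->
  measurable_fun setT (g : sigma_type T A' -> R) ->
  forall B C, measurable B -> measurable C ->
  P (f @^-1` B `&` g @^-1` C) = (P (f @^-1` B) * P (g @^-1` C))%E.
Proof.
move=> iT AA' mf mg B C mB mC; apply: (sigma_of_indep iT AA').
  by have := mf measurableT B mB; rewrite setTI.
by have := mg measurableT C mC; rewrite setTI.
Qed.

Lemma measurable_rsa_iter n s :
  measurable_fun setT (fun x => rsa_iter (times x) n s).
Proof.
elim: n s => [|n IH] s; first exact: measurable_cst.
by apply: measurable_and; apply: measurable_neg; apply: measurable_and => //;
  apply: measurable_fun_ler.
Qed.

Hypothesis hT : iid_uniform01 T.

(** The first site is vacant at time [u] unless it tried by then and before the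
    occupation of the second one.  That second time is independent of the first
    attempt, and the induction hypothesis, valid on every half-line, gives its
    law. *)
Lemma half_time_law (e : int) n i (u : R) : e = 1 \/ e = -1 -> 0 <= u <= 1 ->
  P [set x | u < half_time (times x) e n i] = (exp_taylor R n).[u]%:E.
Proof.
move=> e1; elim: n i u => [|n IH] i u /andP[u0 u1].
  rewrite exp_taylor0 hornerC (_ : [set x | _] = setT) ?probability_setT//.
  by apply/seteqP; split=> // x _ /=; rewrite (le_lt_trans u1)// ltr1n.
have dis : [set i] `&` ray e (i + e) = set0.
  by apply/seteqP; split=> // _ [-> [k]]; case: e1 => ->; lia.
have mi := @measurable_coord _ _ _ P _ T [set i] i erefl.
have mY := @measurable_half_time (ray e (i + e)) e n (i + e) (@subset_refl _ _).
have u01 : 0 <= u <= 1 by rewrite u0.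
have := uniform_lt (hT.2 i) (measurable_sigma_type mY)
  (indep_preimage hT.1 dis mi mY) u01 (fun x => IH (i + e) x).
set E := [set x | _] => PE.
have mE : measurable E.
  apply/measurable_bool_set/measurable_and.
    by apply: measurable_fun_ler.
  by apply: measurable_fun_ltr => //; exact: measurable_sigma_type mY.
rewrite (_ : [set x | _] = ~` E).
  by rewrite probability_setC// PE integral_exp_taylor// -EFinB opprB addrC subrK.
apply/seteqP; split=> x; rewrite /E /= /times.
  by case: ifP => lt ux; apply/negP; rewrite negb_and -ltNge ?orbT ?ux.
move/negP; rewrite negb_and -ltNge; case: ifP => [_|_ _]; first by rewrite orbF.
by rewrite (le_lt_trans u1)// ltr1n.
Qed.

Definition neighbour_time n s x : R :=
  Num.min (half_time (times x) 1 n (s + 1)) (half_time (times x) (-1) n (s - 1)).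

Lemma measurable_neighbour_time n s : measurable_fun setT
  (neighbour_time n s : sigma_type T (ray 1 (s + 1) `|` ray (-1) (s - 1)) -> R).
Proof.
by apply: measurable_minr; apply: measurable_half_time;
  [exact: subsetUl|exact: subsetUr].
Qed.

Lemma neighbour_time_law n s (u : R) : 0 <= u <= 1 ->
  P [set x | u < neighbour_time n s x] = ((exp_taylor R n).[u] ^+ 2)%:E.
Proof.
move=> u01.
pose f x := half_time (times x) 1 n (s + 1).
pose g x := half_time (times x) (-1) n (s - 1).
have dis : ray 1 (s + 1) `&` ray (-1) (s - 1) = set0.
  by apply/seteqP; split=> // _ [[k ->] [l]]; lia.
have -> : [set x | u < neighbour_time n s x] =
    f @^-1` `]u, +oo[%classic `&` g @^-1` `]u, +oo[%classic.
  apply/seteqP; split=> x.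
    by rewrite /neighbour_time /= !in_itv /= !andbT lt_min => /andP.
  by rewrite /neighbour_time /= !in_itv /= !andbT lt_min => /andP.
rewrite (indep_preimage hT.1 dis) ?expr2 ?EFinM.
- rewrite -{1}(@half_time_law 1 n (s + 1) u (or_introl erefl) u01).
  rewrite -(@half_time_law (-1) n (s - 1) u (or_intror erefl) u01).
  by congr (P _ * P _)%E; apply/seteqP; split=> x /=; rewrite in_itv /= andbT.
- exact: measurable_half_time.
- exact: measurable_half_time.
- exact: measurable_itv.
- exact: measurable_itv.
Qed.

(** The domination needed for the limit of the integrals comes for free: these
    polynomials are probabilities. *)
Lemma exp_taylor_01 n (u : R) : 0 <= u <= 1 -> 0 <= (exp_taylor R n).[u] <= 1.
Proof.
move=> u01; rewrite -!lee_fin -(@half_time_law 1 n 0 u (or_introl erefl) u01).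
rewrite measure_ge0 probability_le1//; apply: measurable_bool_set.
apply: measurable_fun_ltr; first exact: measurable_cst.
exact: measurable_sigma_type (@measurable_half_time _ 1 n 0 (@subset_refl _ _)).
Qed.

Lemma times_le1 i : {ae P, forall x, T i x <= 1}.
Proof.
exists (T i @^-1` `]1, +oo[%classic); split.
- by apply: measurable_funPTI; exact: measurable_itv.
- rewrite -[LHS]/(distribution P (T i) _) (hT.2 i); last exact: measurable_itv.
  rewrite /uniform_prob integral_uniform_pdf.
  rewrite (_ : _ `&` _ = set0) ?integral_set0//.
  apply/seteqP; split=> // x []; rewrite /= !in_itv /= andbT => x1 /andP[_].
  by rewrite leNgt x1.
- by move=> x /= /negP; rewrite in_itv /= andbT -ltNge.
Qed.

Lemma times_neq i : {ae P, forall x, T i x != T (i + 1) x}.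
Proof.
exists [set x | T i x = T (i + 1) x]; split.
- rewrite (_ : [set x | _] = [set x | T i x == T (i + 1) x]); last first.
    by apply/seteqP; split=> x /= /eqP.
  by apply/measurable_bool_set/measurable_fun_eqr.
- apply: uniform_neq; [exact: hT.2|exact: hT.2|].
  apply: (indep_preimage hT.1 (_ : [set i] `&` [set i + 1] = set0)).
  + by apply/seteqP; split=> // _ [-> /=]; lia.
  + exact: (@measurable_coord _ _ _ P _ T [set i] i erefl).
  + exact: (@measurable_coord _ _ _ P _ T [set i + 1] (i + 1) erefl).
- by move=> x /= /negP; rewrite negbK => /eqP.
Qed.

Lemma iter_occupied_law n s (t : R) : 0 <= t <= 1 ->
  P [set x | (T s x <= t) && rsa_iter (times x) n.+1 s] =
  (\int[lebesgue_measure]_(x in `[0%R, t]) ((exp_taylor R n).[x] ^+ 2)%R%:E)%E.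
Proof.
move=> t01.
have dis : [set s] `&` (ray 1 (s + 1) `|` ray (-1) (s - 1)) = set0.
  by apply/seteqP; split=> // _ [-> [|] [k]]; lia.
have ms := @measurable_coord _ _ _ P _ T [set s] s erefl.
have mY := @measurable_neighbour_time n s.
rewrite -(uniform_lt (hT.2 s) (measurable_sigma_type mY)
  (indep_preimage hT.1 dis ms mY) t01 (neighbour_time_law n s)).
apply: measure_ae_eq.
- apply/measurable_bool_set/measurable_and; last exact: measurable_rsa_iter.
  exact: measurable_fun_ler.
- apply/measurable_bool_set/measurable_and; first exact: measurable_fun_ler.
  by apply: measurable_fun_ltr => //; exact: measurable_sigma_type mY.
- have h1 := ae_forall_int times_le1.
  have h2 := ae_forall_int times_neq.
  by apply: filterS2 h1 h2 => x le1 neq; rewrite /mkset rsa_iter_half_time.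
Qed.

(** The free choice of [k] lets the limit be taken along the even and along the
    odd iterates separately. *)
Lemma iter_occupied_cvg s (t : R) (k : nat -> nat) : 0 <= t <= 1 ->
  (forall n, (n <= k n)%N) ->
  P [set x | (T s x <= t) && rsa_iter (times x) (k n).+1 s] @[n --> \oo] -->
  ((1 - expR (- (2 * t))) / 2)%:E.
Proof.
move=> t01 nk.
have koo : k n @[n --> \oo] --> \oo.
  by apply/cvgnyPge => A; near=> n; apply: leq_trans (nk n); near: n;
    exact: nbhs_infty_ge.
have h := cvg_comp _ _ koo (cvg_integral_exp_taylor_sqr t01 exp_taylor_01).
apply: cvg_trans h; apply: near_eq_cvg; apply: nearW => n /=.
by rewrite -(@iter_occupied_law _ s _ t01).
Unshelve. all: by end_near. Qed.

Lemma measurable_surely s : measurable [set x | surely_free (times x) s].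
Proof.
rewrite (_ : [set x | _] = \bigcup_n [set x | rsa_iter (times x) n.*2 s]).
  by apply: bigcupT_measurable => n; exact/measurable_bool_set/measurable_rsa_iter.
by apply/seteqP; split=> x; [move=> /asboolP[n] xn; exists n|
  move=> [n _ xn]; apply/asboolP; exists n].
Qed.

Lemma measurable_possibly s : measurable [set x | possibly_free (times x) s].
Proof.
rewrite (_ : [set x | _] = \bigcap_n [set x | rsa_iter (times x) n.*2.+1 s]).
  by apply: bigcapT_measurable => n; exact/measurable_bool_set/measurable_rsa_iter.
by apply/seteqP; split=> x; [move=> /asboolP xn n _; exact: xn|
  move=> xn; apply/asboolP => n; exact: xn].
Qed.

Lemma measurable_attempted_and s (t : R) (Q : Omega -> bool) :
  measurable [set x | Q x] -> measurable [set x | (T s x <= t) && Q x].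
Proof.
move=> mQ; rewrite (_ : [set x | _] = [set x | T s x <= t] `&` [set x | Q x]).
  by apply: measurableI => //; apply/measurable_bool_set; apply: measurable_fun_ler.
by apply/seteqP; split=> x /= /andP.
Qed.

(** The two events lie between an even and an odd iterate, whose probabilities
    have the same limit. *)
Lemma surely_occupied_law s (t : R) : 0 <= t <= 1 ->
  P [set x | (T s x <= t) && surely_free (times x) s] =
    ((1 - expR (- (2 * t))) / 2)%:E /\
  P [set x | (T s x <= t) && possibly_free (times x) s] =
    ((1 - expR (- (2 * t))) / 2)%:E.
Proof.
move=> t01.
have leP (Q Q' : Omega -> bool) : measurable [set x | Q x] ->
    measurable [set x | Q' x] -> (forall x, Q x -> Q' x) ->
    (P [set x | ((T s x <= t) && Q x)%R] <= P [set x | ((T s x <= t) && Q' x)%R])%E.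
  move=> mQ mQ' QQ'; apply: le_measure; rewrite ?inE;
    [exact: measurable_attempted_and..|].
  by move=> x /= /andP[-> /QQ'].
have mr n := measurable_bool_set (@measurable_rsa_iter n s).
set PL := P _; set PG := P _; set l := _%:E.
have LG : (PL <= PG)%E.
  apply: leP; [exact: measurable_surely|exact: measurable_possibly|].
  by move=> x; exact: surely_possibly.
have lL : (l <= PL)%E.
  apply: (cvge_le _ (@iter_occupied_cvg s t (fun n => n.*2.+1) t01 _)).
    apply: nearW => n; apply: leP; [exact: mr|exact: measurable_surely|].
    by move=> x xn; apply/asboolP; exists n.+1.
  by move=> n; lia.
have Gl : (PG <= l)%E.
  apply: (cvge_ge _ (@iter_occupied_cvg s t (fun n => n.*2) t01 _)).
    apply: nearW => n; apply: leP; [exact: measurable_possibly|exact: mr|].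
    by move=> x /asboolP.
  by move=> n; lia.
by split; apply/eqP; rewrite eq_le ?(le_trans LG) ?Gl ?lL ?(le_trans lL).
Qed.

(** At time 1 every site has tried, so equality of the two probabilities leaves
    only a null set on which a site is undetermined. *)
Lemma possibly_surely_ae s :
  {ae P, forall x, possibly_free (times x) s -> surely_free (times x) s}.
Proof.
have l01 : 0 <= (1 : R) <= 1 by rewrite ler01 lexx.
have [PL PG] := surely_occupied_law s l01.
set L := [set x | _] in PL; set G := [set x | _] in PG.
have mL : measurable L by apply: measurable_attempted_and; exact: measurable_surely.
have mG : measurable G by apply: measurable_attempted_and; exact: measurable_possibly.
have LG : L `<=` G by move=> x /andP[T1 /surely_possibly Gx]; apply/andP.
have GL : {ae P, forall x, G x -> L x}.
  exists (G `\` L); split; first exact: measurableD.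
    rewrite measureD//; last by apply: le_lt_trans (ltry 1); exact: probability_le1.
    by rewrite setIidr// -[LHS]/(P G - P L)%E PG PL subee.
  by move=> x /= /not_implyP.
apply: filterS2 (times_le1 s) GL => x T1 GLx Gx.
by have /GLx/andP[] : G x by apply/andP.
Qed.

Lemma omega_law s (t : R) : 0 <= t <= 1 ->
  P [set x | omega T s t x = true] = ((1 - expR (- (2 * t))) / 2)%:E.
Proof.
move=> t01; rewrite -(surely_occupied_law s t01).1.
pose U := [set x | forall r, possibly_free (times x) r -> surely_free (times x) r].
have mU : measurable U.
  pose Q r := ~` [set x | possibly_free (times x) r] `|`
              [set x | surely_free (times x) r].
  rewrite (_ : U = [set x | forall r, Q r x]).
    apply: measurable_forall_int => r; apply: measurableU.
      by apply: measurableC; exact: measurable_possibly.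
    exact: measurable_surely.
  apply/seteqP; split=> x Ux r.
    by have [/Ux|] := pselect (possibly_free (times x) r); [right|left].
  by have [|] := Ux r.
have mA : measurable [set x | (T s x <= t) && surely_free (times x) s].
  by apply: measurable_attempted_and; exact: measurable_surely.
have -> : [set x | omega T s t x = true] =
    U `&` [set x | (T s x <= t) && surely_free (times x) s].
  apply/seteqP; split=> x /=; rewrite /omega rsa_state_free -andbA.
    by move=> /andP[/asboolP].
  by move=> [Ux ->]; rewrite andbT; apply/asboolP.
apply: measure_ae_eq => //; first exact: measurableI.
have := ae_forall_int possibly_surely_ae; apply: filterS => x Ux.
by split=> [[]|].
Qed.

End Process.

Theorem theorem1 (R : realType) (d : measure_display) (Omega : measurableType d)
    (P : probability Omega R) (T : int -> {RV P >-> R})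
    (hT : iid_uniform01 T) (t : R) (ht : 0 <= t <= 1) (s : int) :
  rho T t = P [set x | omega T s t x = true] /\
  P [set x | omega T s t x = true] = ((1 - expR (- (2 * t))) / 2)%:E.
Proof. by rewrite /rho !omega_law. Qed.
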